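(* Let $I\subset(0,\infty)$ be an interval, let $f:I\to\mathbb{R}$ be differentiable on $I^{\circ}$, and let $a,b\in I$ with $a<b$, where $f'$ exists at every point of $[a,b]$ (one-sided derivative at $a$ or $b$ if that point is an endpoint of $I$), and $f'\in L[a,b]$. Let $q>1$, $\frac1p+\frac1q=1$, and suppose $|f'|^q$ is harmonically convex on $[a,b]$. Then $$\left|\frac{f(a)+f(b)}{2}-\frac{ab}{b-a}\int_a^b\frac{f(x)}{x^2}\,dx\right|$$ $$\le\frac{ab(b-a)}{2}\left\{C_1(1,p;a,b)^{\frac1p}\left(\frac{\left|f'\left(\frac{2ab}{a+b}\right)\right|^q+|f'(b)|^q}{4}\right)^{\frac1q}+C_1(1,p;b,a)^{\frac1p}\left(\frac{\left|f'\left(\frac{2ab}{a+b}\right)\right|^q+|f'(a)|^q}{4}\right)^{\frac1q}\right\},$$ where, for $\lambda\in[0,1]$ and $u,\vartheta>0$, $C_1(\lambda,p;u,\vartheta)=\int_0^{1/2}\frac{|\lambda-2t|^p}{(t\vartheta+(1-t)u)^{2p}}\,dt$.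
   Context: A function $g:J\to\mathbb{R}$ on an interval $J\subset\mathbb{R}\setminus\{0\}$ is harmonically convex if $g\left(\frac{xy}{tx+(1-t)y}\right)\le t\,g(y)+(1-t)\,g(x)$ for all $x,y\in J$ and $t\in[0,1]$. $L[a,b]$ denotes the Lebesgue integrable functions on $[a,b]$. *)

(* Defs.v *)
From HB Require Import structures.
From mathcomp Require Import all_boot all_order all_algebra.
From mathcomp Require Import all_classical all_reals all_analysis.

Set Implicit Arguments.
Unset Strict Implicit.
Unset Printing Implicit Defensive.

Import Order.TTheory GRing.Theory Num.Theory.
Import numFieldNormedType.Exports.
Local Open Scope classical_set_scope.
Local Open Scope ring_scope.

(* A real function on an interval I is encoded as a total function f : R -> R
   together with the set I. The increments h are restricted to x + h in I, so
   the values of f outside I are irrelevant: at an endpoint of I this is the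
   one-sided derivative, and at an interior point the usual one, see
   derivable_inE and derive_inE. *)
Definition derivable_in (R : realType) (I : set R) (f : R -> R) (x : R) : Prop :=
  cvg (h^-1 *: (f (h + x) - f x) @[h --> within [set h | I (h + x)] 0^']).

Definition derive_in (R : realType) (I : set R) (f : R -> R) (x : R) : R :=
  lim (h^-1 *: (f (h + x) - f x) @[h --> within [set h | I (h + x)] 0^']).

Lemma within_dnbhs_interior (R : realType) (I : set R) (x : R) :
  I° x -> within [set h | I (h + x)] 0^' = 0^'.
Proof.
move=> Ix; apply/seteqP; split; last first.
  by move=> A hA; apply: filterS hA.
move=> A hA.
have hI : \forall h \near 0^', I (h + x).
  apply: nbhs_dnbhs.
  have shx : (fun h : R => h + x) @ nbhs (0 : R) --> x.
    by rewrite -[X in _ --> X](add0r x); apply: cvgD; [exact: cvg_id | exact: cvg_cst].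
  exact: (shx I Ix).
move: hA; rewrite /within /= => hA; near=> h; have hIh : I (h + x) by near: h.
by move: (hIh); near: h.
Unshelve. all: by end_near.
Qed.

Lemma derivable_inE (R : realType) (I : set R) (f : R -> R) (x : R) :
  I° x -> derivable_in I f x <-> derivable f x 1.
Proof.
move=> Ix; rewrite /derivable_in within_dnbhs_interior// /derivable.
set d := fun h => _; set d' := fun h => _.
by have -> : d = d' by apply/funext => h; rewrite /d /d' /= [h%:A]mulr1.
Qed.

Lemma derive_inE (R : realType) (I : set R) (f : R -> R) (x : R) :
  I° x -> derive_in I f x = 'D_1 f x.
Proof.
by move=> Ix; rewrite /derive_in within_dnbhs_interior// -derive1E.
Qed.

(* Meant for J an interval not containing 0, which keeps the denominator
   nonzero. *)
Definition harmonically_convex (R : realType) (J : set R) (g : R -> R) : Prop :=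
  forall x y t : R, J x -> J y -> 0 <= t <= 1 ->
    g (x * y / (t * x + (1 - t) * y)) <= t * g y + (1 - t) * g x.

(* Meant for 0 <= lambda <= 1 and u, theta > 0, so that the bases of the real
   powers are nonnegative. *)
Definition C1 (R : realType) (lambda p u theta : R) : R :=
  \int[lebesgue_measure]_(t in `[0, 2^-1])
    (`|lambda - 2 * t| `^ p / (t * theta + (1 - t) * u) `^ (2 * p)).

(* Main.v *)
(* Put phi(t) = uv / (t v + (1 - t) u), which runs from v at t = 0 to the
   harmonic mean H = 2uv / (u + v) at t = 1/2, and let Q be a primitive of
   f(x) / x^2.  Then
     Phi(t) = (1 - 2 t) f(phi t) - 2 uv / (v - u) Q(phi t)
   has derivative (1 - 2 t) f'(phi t) phi'(t), and the quantity to estimate is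
   half the sum of the increments of Phi on [0, 1/2] for (u, v) = (a, b) and
   (u, v) = (b, a).  Harmonic convexity bounds |f'(phi t)|^q by
   (1 - 2 t) |f'(v)|^q + 2 t |f'(H)|^q, so Young's inequality with a free
   parameter s bounds |Phi'| by a continuous function.  Comparing derivatives
   then bounds the increment of Phi without integrating f', and optimising s
   turns Young's inequality into the product form of Hoelder's. *)
Require Import Defs.
From HB Require Import structures.
From mathcomp Require Import all_boot all_order all_algebra.
From mathcomp Require Import all_classical all_reals all_analysis.
From mathcomp Require Import measurable_realfun ring lra.

Set Implicit Arguments.
Unset Strict Implicit.
Unset Printing Implicit Defensive.

Import Order.TTheory GRing.Theory Num.Theory.
Import numFieldNormedType.Exports.
Local Open Scope classical_set_scope.
Local Open Scope ring_scope.

(** * Continuity, comparison of increments and the optimised Young inequality *)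

(** For [h != 0], [f (h + x)] is [h] times the difference quotient plus [f x], and the first term
    tends to 0. The punctured filter omits [y = x], where the claim is trivial. This yields
    continuity up to the endpoints of [[a, b]]. *)
Lemma derivable_in_cvg (R : realType) (I : set R) (f : R -> R) (x : R) :
  derivable_in I f x -> f y @[y --> within I (nbhs x)] --> f x.
Proof.
move=> dfx.
have within0 : f (h + x) @[h --> within [set h | I (h + x)] 0^'] --> f x.
  have hE : (fun h : R => h * (h^-1 *: (f (h + x) - f x)) + f x)
      @ within [set h | I (h + x)] 0^' --> f x.
    rewrite -[X in _ --> X]add0r -[X in _ --> X + _](mul0r (derive_in I f x)).
    apply: cvgD; last exact: cvg_cst.
    apply: cvgM; last exact: dfx.
    by apply: cvg_within_filter; exact: nbhs_dnbhs.
  apply: cvg_trans hE; apply: near_eq_cvg; near=> h.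
  rewrite [_ *: _]/(_ * _) mulrA divff ?mul1r ?subrK//.
  near: h; apply: cvg_within; exact: withinT.
move=> B fxB; have := within0 B fxB.
rewrite /= /within /= /nbhs/= -!nbhs_nearE /dnbhs/within /= => h0.
have shiftx : (fun y : R => y - x) @ nbhs x --> (0 : R).
  by rewrite -[X in _ --> X](subrr x); apply: cvgB;
    [exact: cvg_id|exact: cvg_cst].
have := shiftx _ h0; rewrite /= => h1.
near=> y => Iy; have [->|yx] := eqVneq y x; first exact: nbhs_singleton.
have H : y - x != 0 -> I (y - x + x) -> B (f (y - x + x)) by near: y.
by move: H; rewrite subrK subr_eq0; apply.
Unshelve. all: by end_near. Qed.

(** Serves to compose [f] and [Q], known to be continuous only relative to [[a, b]], with the
    harmonic path, which stays in [[a, b]]. *)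
Lemma within_continuous_comp_within (T U V : topologicalType) (A : set T)
    (B : set U) (f : T -> U) (g : U -> V) :
  (forall x, A x -> B (f x)) -> {within A, continuous f} ->
  {within B, continuous g} -> {within A, continuous (g \o f)}.
Proof.
move=> AB /subspace_continuousP cf /subspace_continuousP cg.
apply/subspace_continuousP => x Ax.
apply: cvg_comp (cg _ (AB _ Ax)).
move=> C; rewrite /within /= => hC.
have := cf _ Ax _ hC; rewrite /within /nbhs /= => h.
near=> y => Ay.
have H : A y -> B (f y) -> C (f y) by near: y; exact: h.
exact: H Ay (AB _ Ay).
Unshelve. all: by end_near. Qed.

(** Mean value theorem for [g + e f] with [e = 1] and [e = -1], whose derivative [dg + e df] is
    nonnegative. *)
Lemma norm_subr_le_of_derive (R : realType) (f df g dg : R -> R) (a b : R) :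
  a < b ->
  {within `[a, b], continuous f} -> {within `[a, b], continuous g} ->
  (forall x, x \in `]a, b[ -> is_derive x 1 f (df x)) ->
  (forall x, x \in `]a, b[ -> is_derive x 1 g (dg x)) ->
  (forall x, x \in `]a, b[ -> `|df x| <= dg x) ->
  `|f b - f a| <= g b - g a.
Proof.
move=> ab cf cg f' g' dfg.
have gDf e : `|e| = 1 -> 0 <= (g b - g a) + e * (f b - f a).
  move=> e1.
  have [||c cab] := @MVT R (g + e *: f) (fun x => dg x + e *: df x) a b ab.
  - move=> x xab; apply: is_deriveD; first exact: g'.
    by apply: is_deriveZ; exact: f'.
  - move=> x; apply: cvgD; first exact: cg.
    by apply: cvgZl_tmp; exact: cf.
  rewrite ![(_ + _) _]/(_ + _) ![(_ *: _) _]/(_ * _) => h.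
  rewrite (_ : _ + _ = g b + e * f b - (g a + e * f a)); last by ring.
  rewrite h mulr_ge0 ?subr_ge0 ?(ltW ab)//.
  rewrite -lerBlDr sub0r (le_trans (ler_norm _))// normrN normrM e1 mul1r.
  exact: dfg.
rewrite ler_norml.
have := gDf 1 (normr1 _); have := gDf (-1) (normrN1 _).
rewrite mulN1r mul1r => ? ?; apply/andP; split; lra.
Qed.

(** The product is the infimum over [s] of the Young bounds. If [x] or [y] is 0, the product is 0
    and is reached in the limit [s] to infinity or to 0 respectively, hence the argument with an
    arbitrary [e > 0]. *)
Lemma le_hoelder_of_young (R : realType) (p q x y z : R) :
  0 < p -> 0 < q -> p^-1 + q^-1 = 1 -> 0 <= x -> 0 <= y ->
  (forall s, 0 < s -> z <= s `^ p * x / p + s `^ (- q) * y / q) ->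
  z <= x `^ p^-1 * y `^ q^-1.
Proof.
move=> p0 q0 pq; rewrite le_eqVlt => /predU1P[<- |x0].
  move=> y0 H; rewrite powR0 ?invr_neq0 ?gt_eqF// mul0r.
  apply/ler_addgt0Pl => e e0.
  have d0 : 0 < y / q + 1 by rewrite ltr_wpDl// divr_ge0// ltW.
  (* This [s] solves [s^(-q) = e / (y / q + 1)], which makes the bound at most [e]; the summand 1
     keeps the denominator positive when [y = 0]. *)
  have := H ((e / (y / q + 1)) `^ (- q^-1)) (powR_gt0 _ (divr_gt0 e0 d0)).
  rewrite mulr0 mul0r add0r -powRrM mulrNN mulVf ?gt_eqF// powRr1; last first.
    by rewrite divr_ge0// ltW.
  move=> /le_trans; apply; rewrite addr0 -mulrA mulrAC ler_pdivrMr//.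
  by rewrite ler_pM2l// lerDl.
rewrite le_eqVlt => /predU1P[<- |y0] H.
  rewrite [0 `^ _]powR0 ?invr_neq0 ?gt_eqF// mulr0.
  apply/ler_addgt0Pl => e e0.
  have d0 : 0 < x / p + 1 by rewrite ltr_wpDl// divr_ge0// ltW.
  have := H ((e / (x / p + 1)) `^ (p^-1)) (powR_gt0 _ (divr_gt0 e0 d0)).
  rewrite mulr0 mul0r addr0 -powRrM mulVf ?gt_eqF// powRr1; last first.
    by rewrite divr_ge0// ltW.
  move=> /le_trans; apply; rewrite addr0 -mulrA mulrAC ler_pdivrMr//.
  by rewrite ler_pM2l// lerDl.
set d := _ * _.
have d0 : 0 < d by rewrite mulr_gt0 ?powR_gt0.
(* The minimising s makes the two summands equal to d/p and d/q. *)
have := H (y `^ (p * q)^-1 / x `^ (p * q)^-1) _; rewrite divr_gt0 ?powR_gt0//.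
move=> /(_ isT) /le_trans; apply.
suff [-> ->] : (y `^ (p * q)^-1 / x `^ (p * q)^-1) `^ p * x = d /\
  (y `^ (p * q)^-1 / x `^ (p * q)^-1) `^ (- q) * y = d.
  by rewrite -mulrDr pq mulr1.
have p1 : p^-1 = 1 - q^-1 by rewrite -pq addrK.
have q1 : q^-1 = 1 - p^-1 by rewrite -pq addrAC subrr add0r.
have pn : p != 0 by rewrite gt_eqF.
have qn : q != 0 by rewrite gt_eqF.
(* Here [s^p = (y / x)^(1/q)] and [s^(-q) = (x / y)^(1/p)]. *)
rewrite -!powRN !powRM ?powR_ge0// -!powRrM.
have -> : (p * q)^-1 * p = q^-1 by field; rewrite pn qn.
have -> : - (p * q)^-1 * p = - q^-1 by field; rewrite pn qn.
have -> : (p * q)^-1 * - q = - p^-1 by field; rewrite pn qn.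
have -> : - (p * q)^-1 * - q = p^-1 by field; rewrite pn qn.
split.
  rewrite -mulrA -[X in _ * X = _]mulrC -{1}[x]powRr1 ?ltW//.
  rewrite -powRD ?(gt_eqF x0) ?implybT//.
  by rewrite -p1 mulrC.
rewrite mulrAC -{2}[y]powRr1 ?ltW// -powRD ?(gt_eqF y0) ?implybT//.
by rewrite addrC -q1 mulrC.
Qed.

(** * The harmonic path and the integrand of [C1] *)

Definition C1_integrand (R : realType) (p u v t : R) : R :=
  `|1 - 2 * t| `^ p / (t * v + (1 - t) * u) `^ (2 * p).

(** A weighted harmonic mean: its reciprocal [t / u + (1 - t) / v] is affine in [t]. *)
Definition harmonic_path (R : realType) (u v t : R) : R :=
  u * v / (t * v + (1 - t) * u).

Lemma harmonic_den_ge (R : realType) (u v t : R) :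
  0 < u -> 0 < v -> t \in `[0, 2^-1] ->
  Num.min u v <= t * v + (1 - t) * u.
Proof.
move=> u0 v0; rewrite in_itv/= => /andP[t0 t1]; rewrite ge_min.
by case: (lerP u v) => uv; apply/orP; [left|right]; nra.
Qed.

Lemma harmonic_den_gt0 (R : realType) (u v t : R) :
  0 < u -> 0 < v -> t \in `[0, 2^-1] -> 0 < t * v + (1 - t) * u.
Proof.
move=> u0 v0 /(harmonic_den_ge u0 v0).
by apply: lt_le_trans; rewrite lt_min u0.
Qed.

Lemma is_derive_harmonic_den (R : realType) (u v t : R) :
  is_derive t 1 (fun t => t * v + (1 - t) * u) (v - u).
Proof.
apply: is_derive_eq; rewrite /GRing.scale/=; ring.
Qed.

Lemma is_derive_harmonic_path (R : realType) (u v t : R) :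
  0 < u -> 0 < v -> t \in `[0, 2^-1] ->
  is_derive t 1 (harmonic_path u v)
    (- (u * v * (v - u) / (t * v + (1 - t) * u) ^+ 2)).
Proof.
move=> u0 v0 /(harmonic_den_gt0 u0 v0) D0.
have D : t * v + (1 - t) * u != 0 by rewrite gt_eqF.
have d1 := is_derive_harmonic_den u v t.
have d2 := @is_deriveV _ (fun t => t * v + (1 - t) * u) _ _ _ D d1.
apply: (is_derive_eq (@is_deriveZ _ _ _ _ (u * v) _ _ _ d2)).
rewrite /GRing.scale/=.
by field.
Qed.

Lemma C1_integrand_ge0 (R : realType) (p u v t : R) : 0 <= C1_integrand p u v t.
Proof. by rewrite divr_ge0// powR_ge0. Qed.

(** The integrand is measurable and bounded: the numerator is at most 1 and the denominator at least
    [min(u, v)^(2p)]. *)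
Lemma integrable_C1_integrand (R : realType) (p u v : R) :
  0 < u -> 0 < v -> 0 < p ->
  lebesgue_measure.-integrable `[0, 2^-1] (EFin \o C1_integrand p u v).
Proof.
move=> u0 v0 p0; apply: measurable_bounded_integrable => //.
- exact/compact_finite_measure/segment_compact.
- apply: (measurable_funS measurableT) => //.
  have -> : C1_integrand p u v = (fun t => `|1 - 2 * t| `^ p *
      (t * v + (1 - t) * u) `^ - (2 * p)).
    by apply/funext => t; rewrite powRN.
  apply: measurable_funM.
    apply: (measurableT_comp (measurable_powR _)).
    apply: measurableT_comp => //; apply: measurable_funB => //.
  apply: (measurableT_comp (measurable_powR _)); apply: measurable_funD.
    exact: mulrr_measurable.
  apply: (measurableT_comp (mulrr_measurable u)).
  exact: measurable_funB.
exists ((Num.min u v `^ (2 * p))^-1); split; first exact: num_real.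
move=> M ltM t t01; rewrite /= ger0_norm ?C1_integrand_ge0//.
rewrite (le_trans _ (ltW ltM))//.
have m0 : 0 < Num.min u v by rewrite lt_min u0.
have D0 := harmonic_den_gt0 u0 v0 t01.
rewrite ler_pdivrMr ?powR_gt0// (@le_trans _ _ (1 `^ p))//.
  rewrite ge0_ler_powR ?nnegrE ?(ltW p0)//.
  by move: t01; rewrite /= in_itv/= => /andP[? ?]; rewrite ler_norml; lra.
rewrite powR1 mulrC ler_pdivlMr ?powR_gt0// mul1r.
rewrite ge0_ler_powR ?nnegrE ?(ltW D0) ?(ltW m0) ?harmonic_den_ge//.
by rewrite mulr_ge0// ltW.
Qed.

Lemma is_derive_continuous (R : realType) (f : R -> R) (df x : R) :
  is_derive x 1 f df -> {for x, continuous f}.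
Proof. by case=> /derivable1_diffP/differentiable_continuous. Qed.

(** Continuity comes from differentiability of real powers at positive bases; the base [|1 - 2t|]
    vanishes at [t = 1/2], hence the open interval. *)
Lemma continuous_C1_integrand (R : realType) (p u v t : R) :
  0 < u -> 0 < v -> t \in `]0, 2^-1[ ->
  {for t, continuous (C1_integrand p u v)}.
Proof.
move=> u0 v0 t01.
have t0 : 0 < 1 - 2 * t by move: t01; rewrite in_itv/= => /andP[]; lra.
have D0 : 0 < t * v + (1 - t) * u.
  exact/(harmonic_den_gt0 u0 v0)/subset_itv_oo_cc.
have -> : C1_integrand p u v = (fun t => `|1 - 2 * t| `^ p *
    (t * v + (1 - t) * u) `^ - (2 * p)).
  by apply/funext => s; rewrite powRN.
have dn : {for t, continuous (fun t : R => `|1 - 2 * t|)}.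
  apply: cvg_norm; apply: cvgB; first exact: cvg_cst.
  by apply: cvgMl_tmp; exact: cvg_id.
have n0 : 0 < `|1 - 2 * t| by rewrite normr_gt0 gt_eqF.
exact: (cvgM
  (continuous_comp dn (is_derive_continuous (is_derive1_powR p n0)))
  (continuous_comp (is_derive_continuous (is_derive_harmonic_den u v t))
    (is_derive_continuous (is_derive1_powR (- (2 * p)) D0)))).
Qed.

(** With [D] the denominator, [uv - aD] and [bD - uv] are positive combinations of the distances of
    [u] and [v] to [a], respectively to [b]. As [u != v], one distance of each pair is positive. *)
Lemma harmonic_path_open (R : realType) (a b u v t : R) :
  0 < u -> 0 < v -> u != v ->
  u \in `[a, b] -> v \in `[a, b] -> t \in `]0, 2^-1[ ->
  harmonic_path u v t \in `]a, b[.
Proof.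
move=> u0 v0 uv; rewrite !in_itv/= => /andP[au ub] /andP[av vb] t01.
have D0 : 0 < t * v + (1 - t) * u.
  exact/(harmonic_den_gt0 u0 v0)/subset_itv_oo_cc.
move: t01 => /andP[t0 t1].
have s0 : 0 < 1 - t by lra.
have tv := mulr_gt0 t0 v0; have su := mulr_gt0 s0 u0.
rewrite /harmonic_path ltr_pdivlMr// ltr_pdivrMr//.
have e1 : u * v - a * (t * v + (1 - t) * u) =
  t * v * (u - a) + (1 - t) * u * (v - a) by ring.
have e2 : b * (t * v + (1 - t) * u) - u * v =
  t * v * (b - u) + (1 - t) * u * (b - v) by ring.
rewrite -subr_gt0 e1 -[X in _ && X]subr_gt0 e2.
move: uv; rewrite neq_lt => /orP[uv|uv].
- have h1 : 0 < v - a by lra.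
  have h2 : 0 < b - u by lra.
  have h3 : 0 <= u - a by lra.
  have h4 : 0 <= b - v by lra.
  by rewrite ltr_wpDl ?ltr_wpDr// ?mulr_gt0// mulr_ge0// ltW.
- have h1 : 0 < u - a by lra.
  have h2 : 0 < b - v by lra.
  have h3 : 0 <= v - a by lra.
  have h4 : 0 <= b - u by lra.
  by rewrite ltr_wpDr ?ltr_wpDl// ?mulr_gt0// mulr_ge0// ltW.
Qed.

Lemma harmonic_path_closed (R : realType) (a b u v t : R) :
  0 < u -> 0 < v ->
  u \in `[a, b] -> v \in `[a, b] -> t \in `[0, 2^-1] ->
  harmonic_path u v t \in `[a, b].
Proof.
move=> u0 v0; rewrite !in_itv/= => /andP[au ub] /andP[av vb] t01.
have D0 := harmonic_den_gt0 u0 v0 t01.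
move: t01 => /andP[t0 t1].
have s0 : 0 <= 1 - t by lra.
rewrite /harmonic_path ler_pdivlMr// ler_pdivrMr//.
have e1 : u * v - a * (t * v + (1 - t) * u) =
  t * v * (u - a) + (1 - t) * u * (v - a) by ring.
have e2 : b * (t * v + (1 - t) * u) - u * v =
  t * v * (b - u) + (1 - t) * u * (b - v) by ring.
rewrite -subr_ge0 e1 -[X in _ && X]subr_ge0 e2.
apply/andP; split; apply: addr_ge0; apply: mulr_ge0; rewrite ?subr_ge0//.
all: by rewrite mulr_ge0 ?(ltW u0) ?(ltW v0).
Qed.

(** Reciprocals along the path are affine and [t = (1 - 2t) 0 + 2t (1/2)], so the point at [t] is
    the harmonic mean of [v] and the midpoint value with weights [1 - 2t] and [2t]. *)
Lemma harmonically_convex_path_le (R : realType) (a b u v t : R) (g : R -> R) :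
  0 < u -> 0 < v -> harmonically_convex `[a, b] g ->
  u \in `[a, b] -> v \in `[a, b] -> t \in `[0, 2^-1] ->
  g (harmonic_path u v t) <=
    (1 - 2 * t) * g v + 2 * t * g (2 * u * v / (u + v)).
Proof.
move=> u0 v0 gconv ui vi ti.
have D0 := harmonic_den_gt0 u0 v0 ti.
have hE : 2 * u * v / (u + v) = harmonic_path u v 2^-1.
  by rewrite /harmonic_path; field; rewrite ?gt_eqF// ?addr_gt0//; lra.
have hi : 2^-1 \in `[0, 2^-1 : R] by rewrite in_itv/= lexx andbT invr_ge0.
have := gconv (2 * u * v / (u + v)) v (1 - 2 * t).
rewrite /= {1}hE => /(_ (harmonic_path_closed u0 v0 ui vi hi) vi).
have -> : 2 * u * v / (u + v) * v /
  ((1 - 2 * t) * (2 * u * v / (u + v)) + (1 - (1 - 2 * t)) * v) =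
  harmonic_path u v t.
  have uv0 : u + v != 0 by rewrite gt_eqF// addr_gt0.
  have vn : v != 0 by rewrite gt_eqF.
  have Dn : t * v + (1 - t) * u != 0 by rewrite gt_eqF.
  rewrite (_ : _ + _ * v = 2 * v * (t * v + (1 - t) * u) / (u + v)); last first.
    by field.
  rewrite /harmonic_path; field; rewrite ?Dn ?vn ?uv0//.
move: ti; rewrite in_itv/= => /andP[t0 t1].
have -> : 1 - (1 - 2 * t) = 2 * t by ring.
by apply; apply/andP; split; lra.
Qed.

(** * The estimate along one half of the path *)

(** The order of [u] and [v] is left open, so that both [(a, b)] and [(b, a)] are covered. *)
Lemma half_increment_le (R : realType) (f df Q : R -> R) (a b u v p q : R) :
  0 < u -> 0 < v -> u != v -> u \in `[a, b] -> v \in `[a, b] ->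
  0 < p -> 0 < q -> p^-1 + q^-1 = 1 ->
  {within `[a, b], continuous f} -> {within `[a, b], continuous Q} ->
  (forall x, x \in `]a, b[ -> is_derive x 1 f (df x)) ->
  (forall x, x \in `]a, b[ -> is_derive x 1 Q (f x / x ^+ 2)) ->
  harmonically_convex `[a, b] (fun x => `|df x| `^ q) ->
  `| 2 * (u * v / (v - u)) * (Q v - Q (2 * u * v / (u + v))) - f v | <=
  u * v * `|v - u| * (C1 1 p u v `^ p^-1 *
    ((`|df (2 * u * v / (u + v))| `^ q + `|df v| `^ q) / 4) `^ q^-1).
Proof.
move=> u0 v0 uv ui vi p0 q0 pq cf cQ f' Q' dfconv.
set H := 2 * u * v / (u + v); set k := u * v * `|v - u|.
have k0 : 0 < k by rewrite !mulr_gt0// normr_gt0 subr_eq0 eq_sym.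
rewrite -ler_pdivrMl//.
have C10 : 0 <= C1 1 p u v.
  by apply: Rintegral_ge0 => t _; rewrite divr_ge0// powR_ge0.
apply: le_hoelder_of_young => //.
move=> s s0; rewrite ler_pdivrMl//.
(* The factor [1 - 2t] vanishes at [t = 1/2], so of the values of [f] only [f v] survives in the
   increment. *)
pose Phi (t : R) : R := (1 - 2 * t) * f (harmonic_path u v t)
  - 2 * (u * v / (v - u)) * Q (harmonic_path u v t).
pose dPhi (t : R) : R := - ((1 - 2 * t) * df (harmonic_path u v t) *
  (u * v * (v - u) / (t * v + (1 - t) * u) ^+ 2)).
pose E (t : R) : R :=
  \int[lebesgue_measure]_(x in `[0, t]) C1_integrand p u v x.
pose B := `|df v| `^ q; pose G := `|df H| `^ q.
(* [M] is the primitive of the Young bound [dM] with [M 0 = 0]. At [t = 1/2] its polynomial part is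
   [B / 2 + (G - B) / 4 = (G + B) / 4], the source of the 4 in the statement. *)
pose M (t : R) : R :=
  k * (s `^ p / p * E t + s `^ (- q) / q * (B * t + (G - B) * t ^+ 2)).
pose dM (t : R) : R := k * (s `^ p * C1_integrand p u v t / p +
  s `^ (- q) * ((1 - 2 * t) * B + 2 * t * G) / q).
have half0 : 0 < (2^-1 : R) by rewrite invr_gt0.
have uvn : v - u != 0 by rewrite subr_eq0 eq_sym.
have h0 : harmonic_path u v 0 = v.
  by rewrite /harmonic_path; field; rewrite ?gt_eqF.
have hH : harmonic_path u v 2^-1 = H.
  by rewrite /harmonic_path/H; field; rewrite ?gt_eqF// ?addr_gt0//; lra.
have -> : 2 * (u * v / (v - u)) * (Q v - Q H) - f v = Phi 2^-1 - Phi 0.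
  by rewrite /Phi h0 hH; field.
have M0 : M 0 = 0 by rewrite /M /E set_itv1 Rintegral_set1; ring.
have M12 : M 2^-1 =
    k * (s `^ p * C1 1 p u v / p + s `^ (- q) * ((G + B) / 4) / q).
  rewrite /M (_ : E 2^-1 = C1 1 p u v)//.
  by field; rewrite !gt_eqF.
suff : `|Phi 2^-1 - Phi 0| <= M 2^-1 - M 0 by rewrite M0 subr0 M12.
have sub (t : R) : t \in `]0, 2^-1[ -> t \in `[0, 2^-1 : R].
  exact: subset_itv_oo_cc.
have cpath : {within `[0, 2^-1], continuous (harmonic_path u v)}.
  apply: continuous_in_subspaceT => t; rewrite inE /= => ti.
  exact: is_derive_continuous (is_derive_harmonic_path u0 v0 ti).
have iE := integrable_C1_integrand u0 v0 p0.
have hpi (t : R) : `[0, 2^-1]%classic t ->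
    `[a, b]%classic (harmonic_path u v t).
  exact: harmonic_path_closed.
have cPhi : {within `[0, 2^-1], continuous Phi}.
  move=> t; apply: cvgB; last first.
    by apply: cvgMl_tmp; exact: (within_continuous_comp_within hpi cpath cQ).
  apply: cvgM; last exact: (within_continuous_comp_within hpi cpath cf).
  have c : continuous (fun t : R => 1 - 2 * t).
    by move=> x; apply: cvgB; [exact: cvg_cst|apply: cvgMl_tmp; exact: cvg_id].
  exact: (continuous_subspaceT c).
have cM : {within `[0, 2^-1], continuous M}.
  have cE := parameterized_integral_continuous (ltW half0) iE.
  move=> t; apply: cvgMl_tmp; apply: cvgD; apply: cvgMl_tmp.
    exact: cE.
  have c : continuous (fun t : R => B * t + (G - B) * t ^+ 2).
    move=> x; apply: cvgD; apply: cvgMl_tmp; first exact: cvg_id.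
    exact: exprn_continuous.
  exact: (continuous_subspaceT c).
have Phi' (t : R) : t \in `]0, 2^-1[ -> is_derive t 1 Phi (dPhi t).
  move=> ti.
  have hd := is_derive_harmonic_path u0 v0 (sub _ ti).
  have hi := harmonic_path_open u0 v0 uv ui vi ti.
  have fd := is_derive1_comp (f' _ hi) hd.
  have Qd := is_derive1_comp (Q' _ hi) hd.
  have D := lt0r_neq0 (harmonic_den_gt0 u0 v0 (sub _ ti)).
  have ld : is_derive t 1 (fun t : R => 1 - 2 * t) (- 2).
    by apply: is_derive_eq; rewrite /GRing.scale/=; ring.
  (* As [phi' / phi^2 = -(v - u) / (uv)], the [Q] term contributes [2 f(phi)], which cancels the
     [-2 f(phi)] coming from [1 - 2t]. *)
  apply: (is_derive_eq (is_deriveB (is_deriveM ld fd)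
    (is_deriveZ (2 * (u * v / (v - u))) Qd))).
  rewrite /dPhi /GRing.scale/= /harmonic_path.
  field.
  by rewrite D uvn !gt_eqF.
have M' (t : R) : t \in `]0, 2^-1[ -> is_derive t 1 M (dM t).
  move=> ti; have := ti; rewrite in_itv/= => /andP[t0 t1].
  have [dE E'] :=
    continuous_FTC1_closed t1 iE t0
      (@continuous_C1_integrand _ p u v t u0 v0 ti).
  have Ed : is_derive t 1 E (C1_integrand p u v t).
    by split; [exact: dE|rewrite -derive1E; exact: E'].
  have Pd : is_derive t 1 (fun t : R => B * t + (G - B) * t ^+ 2)
      (B + (G - B) * (2 * t)).
    by apply: is_derive_eq; rewrite /GRing.scale/=; ring.
  apply: (is_derive_eq (is_deriveZ k (is_deriveD (is_deriveZ (s `^ p / p) Ed)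
    (is_deriveZ (s `^ (- q) / q) Pd)))).
  by rewrite /dM /GRing.scale/=; field; rewrite !gt_eqF.
have dPhiM (t : R) : t \in `]0, 2^-1[ -> `|dPhi t| <= dM t.
  move=> ti; have Dt := harmonic_den_gt0 u0 v0 (sub _ ti).
  have := ti; rewrite in_itv/= => /andP[t0 t1].
  have l0 : 0 <= 1 - 2 * t by lra.
  have w0 : 0 <= (1 - 2 * t) / (t * v + (1 - t) * u) ^+ 2.
    by rewrite divr_ge0// exprn_ge0// ltW.
  (* The two factors for Young's inequality, balanced by [s]: the [p]-th power of the first is [s^p]
     times the integrand of [C1], and convexity bounds the [q]-th power of the second. *)
  have -> : `|dPhi t| = k * ((s * ((1 - 2 * t) / (t * v + (1 - t) * u) ^+ 2)) *
      (`|df (harmonic_path u v t)| / s)).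
    rewrite /dPhi normrN !normrM normfV (ger0_norm l0) normrX.
    rewrite (gtr0_norm u0) (gtr0_norm v0) (gtr0_norm Dt) /k.
    by field; rewrite !gt_eqF.
  rewrite ler_pM2l//.
  apply: le_trans (conjugate_powR _ _ p0 q0 pq) _.
  - by rewrite mulr_ge0// ltW.
  - by rewrite divr_ge0// ltW.
  have inv_powR (x r : R) : 0 <= x -> x^-1 `^ r = x `^ (- r).
    by move=> x0; rewrite -powR_inv1// -powRrM mulN1r.
  have wE : ((1 - 2 * t) / (t * v + (1 - t) * u) ^+ 2) `^ p =
      C1_integrand p u v t.
    rewrite /C1_integrand (ger0_norm l0) powRM ?invr_ge0 ?exprn_ge0 ?(ltW Dt)//.
    rewrite inv_powR ?exprn_ge0 ?(ltW Dt)// -powR_mulrn ?(ltW Dt)// -powRrM.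
    by rewrite mulrN powRN.
  rewrite powRM ?(ltW s0)// wE powRM ?invr_ge0 ?(ltW s0)// inv_powR ?(ltW s0)//.
  apply: lerD; first exact: lexx.
  rewrite ler_pM2r ?invr_gt0// mulrC ler_pM2l ?powR_gt0//.
  exact: (harmonically_convex_path_le u0 v0 dfconv ui vi (sub _ ti)).
(* Unification would otherwise unfold the integral inside M. *)
clear - half0 cPhi cM Phi' M' dPhiM; clearbody Phi dPhi M dM.
exact: norm_subr_le_of_derive half0 cPhi cM Phi' M' dPhiM.
Qed.

(** * Combination of the two halves *)

(** Swapping [a] and [b] changes the sign of [ab / (b - a)], so [Qm] cancels in [S + T]. The 0
    stands for the primitive at [a]. *)
Lemma norm_average_le (R : realFieldType) (a b fa fb Qb Qm X Y : R) :
  a < b ->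
  `| 2 * (a * b / (b - a)) * (Qb - Qm) - fb | <= a * b * (b - a) * X ->
  `| 2 * (b * a / (a - b)) * (0 - Qm) - fa | <= b * a * (b - a) * Y ->
  `| (fa + fb) / 2 - a * b / (b - a) * Qb | <= a * b * (b - a) / 2 * (X + Y).
Proof.
move=> ab; set S := _ - fb; set T := _ - fa => hS hT.
have -> : (fa + fb) / 2 - a * b / (b - a) * Qb = - ((S + T) / 2).
  by rewrite /S /T; field; rewrite !subr_eq0 (lt_eqF ab) (gt_eqF ab).
rewrite normrN normrM [`|2^-1|]ger0_norm ?invr_ge0// ler_pdivrMr//.
apply: le_trans (ler_normD _ _) _.
rewrite (_ : _ * 2 = a * b * (b - a) * X + b * a * (b - a) * Y); last by field.
exact: lerD.
Qed.

Theorem corollary5 (R : realType) (I : set R) (f : R -> R) (a b p q : R)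
  (I_interval : is_interval I)
  (I_pos : I `<=` `]0, +oo[)
  (f_derivable : forall x, I° x -> derivable f x 1)
  (Ia : I a) (Ib : I b) (ltab : a < b)
  (f_derivable_ab : forall x, x \in `[a, b] -> derivable_in I f x)
  (f'_integrable :
    lebesgue_measure.-integrable `[a, b] (EFin \o derive_in I f))
  (q_gt1 : 1 < q) (pq_conj : p^-1 + q^-1 = 1)
  (f'_hconvex :
    harmonically_convex `[a, b] (fun x => `|derive_in I f x| `^ q)) :
  let f' := derive_in I f in
  `| (f a + f b) / 2 -
     a * b / (b - a) * \int[lebesgue_measure]_(x in `[a, b]) (f x / x ^+ 2) |
  <= a * b * (b - a) / 2 *
     (C1 1 p a b `^ p^-1 *
        ((`|f' (2 * a * b / (a + b))| `^ q + `|f' b| `^ q) / 4) `^ q^-1 +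
      C1 1 p b a `^ p^-1 *
        ((`|f' (2 * a * b / (a + b))| `^ q + `|f' a| `^ q) / 4) `^ q^-1).

Proof.
cbv zeta; set df := derive_in I f.
have a0 : 0 < a by have := I_pos _ Ia; rewrite /= in_itv/= andbT.
have b0 : 0 < b := lt_trans a0 ltab.
have q0 : 0 < q := lt_trans ltr01 q_gt1.
have p0 : 0 < p.
  have pE : p^-1 = 1 - q^-1 by rewrite -pq_conj addrK.
  by rewrite -invr_gt0 pE subr_gt0 invf_lt1.
have Iab x : x \in `[a, b] -> I x.
  by rewrite in_itv/= => /(I_interval _ _ Ia Ib); exact.
have Ioo x : x \in `]a, b[ -> I° x.
  move=> xab; apply: filterS (near_in_itvoo xab) => z zab.
  exact/Iab/subset_itv_oo_cc.
have f' x : x \in `]a, b[ -> is_derive x 1 f (df x).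
  move=> xab; have Ix := Ioo _ xab.
  by split; [exact: f_derivable|rewrite /df derive_inE].
have cf : {within `[a, b], continuous f}.
  (* Continuity relative to [I] restricts to [[a, b]]; this includes the endpoints, where the
     derivative may be one-sided. *)
  apply/subspace_continuousP => x xab.
  apply: cvg_trans (derivable_in_cvg (f_derivable_ab _ xab)).
  by apply: cvg_app; apply: within_subset => z; exact: Iab.
pose g x := f x / x ^+ 2.
have cV x : 0 < x -> {for x, continuous (fun x : R => (x ^+ 2)^-1)}.
  move=> x0; apply: cvgV; first by rewrite expf_neq0// gt_eqF.
  exact: exprn_continuous.
have cg : {within `[a, b], continuous g}.
  move=> x; apply: cvgM; first exact: cf.
  have c : {within `[a, b], continuous (fun x : R => (x ^+ 2)^-1)}.
    apply: continuous_in_subspaceT => z; rewrite inE/= in_itv/= => /andP[az _].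
    exact/cV/(lt_le_trans a0).
  exact: c.
have ig : lebesgue_measure.-integrable `[a, b] (EFin \o g).
  by apply: continuous_compact_integrable => //; exact: segment_compact.
pose Q x := \int[lebesgue_measure]_(t in `[a, x]) g t.
have cQ : {within `[a, b], continuous Q}.
  exact: parameterized_integral_continuous (ltW ltab) ig.
have Q' x : x \in `]a, b[ -> is_derive x 1 Q (f x / x ^+ 2).
  move=> xab; have := xab; rewrite in_itv/= => /andP[ax xb].
  have cgx : {for x, continuous g}.
    apply: cvgM; last exact/cV/(lt_trans a0).
    exact: is_derive_continuous (f' _ xab).
  have [dQ Q'] := continuous_FTC1_closed xb ig ax cgx.
  by split; [exact: dQ|rewrite -derive1E; exact: Q'].
have Qa : Q a = 0 by rewrite /Q set_itv1 Rintegral_set1.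
have aab : a \in `[a, b] by rewrite in_itv/= lexx ltW.
have bab : b \in `[a, b] by rewrite in_itv/= lexx ltW.
have ab : a != b by rewrite lt_eqF.
have ba : b != a by rewrite gt_eqF.
have := half_increment_le a0 b0 ab aab bab p0 q0 pq_conj cf cQ f' Q' f'_hconvex.
have := half_increment_le b0 a0 ba bab aab p0 q0 pq_conj cf cQ f' Q' f'_hconvex.
(* Both halves must end at syntactically the same harmonic mean for [Qm] to be shared. *)
rewrite (_ : 2 * b * a / (b + a) = 2 * a * b / (a + b)); last first.
  by rewrite [b + a]addrC; congr (_ / _); ring.
rewrite (distrC a b) (gtr0_norm (_ : 0 < b - a)) ?subr_gt0// Qa.
move=> h2 h1; exact: norm_average_le ltab h1 h2.
Qed.
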